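(* Define $\mathcal I^{\star}=\{i\in[V]:\mathcal C_i\cap\operatorname{argmin}_{u\in\mathbb R^r}g_0(u)\neq\emptyset\}$ and $$\alpha=\min_{u\in\bigcup_{i\in[V]\setminus\mathcal I^{\star}}\mathcal C_i}g_0(u)-\min_{u\in\mathbb R^r}g_0(u),\qquad \gamma_i=\operatorname{dist}\left(\mathrm Bv^{(i)},\operatorname{bd}(\mathcal C_i)\right)\quad(i\in\mathcal I^{\star}),$$ $$\Delta_i=\min\left\{\kappa_{c-\mathrm B^{\intercal}\mathrm Bv^{(i)}},\ \frac{\gamma_i}{2}\min_{\substack{k\in[V]\\ \mathrm Bv^{(k)}\neq \mathrm Bv^{(i)}}}\left\|\mathrm Bv^{(k)}-\mathrm Bv^{(i)}\right\|\right\}\quad(i\in\mathcal I^{\star}),$$ $\gamma=\min_{i\in\mathcal I^{\star}}\gamma_i$ and $\Delta=\min_{i\in\mathcal I^{\star}}\Delta_i$. Then, for every $$0<\varepsilon<\min\left\{\frac{\alpha}{R_{\mathsf H}},\frac{\gamma^2}{8R_{\mathsf H}},\frac{\Delta}{R_1+R_{\mathsf H}}\right\}$$ and any solution $x^\star_\varepsilon$ of $\min_{x\in\mathcal K}\{-\frac12x^{\intercal}\mathrm Mx+c^{\intercal}x-\varepsilon\mathsf H(x)\}$, $$0\le-\tfrac12(x^\star_\varepsilon)^{\intercal}\mathrm Mx^\star_\varepsilon+c^{\intercal}x^\star_\varepsilon-\min_{x\in\mathcal K}\left\{-\tfrac12x^{\intercal}\mathrm Mx+c^{\intercal}x\right\}\le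 K\exp\left(\frac{-\Delta}{\varepsilon R_1}+\frac{R_1+R_{\mathsf H}}{R_1}\right),$$ where $K=\max\{4R_1^2\|\mathrm M\|_{\mathrm{op}},\,2\|c\|R_1\}$.
   Context: Let $\mathrm A\in\mathbb R^{m\times n}$, $b\in\mathbb R^m$, $c\in\mathbb R^n$, $\mathcal K=\{x\in\mathbb R^n:\mathrm Ax=b,\ x\ge 0\}$, and let $\mathrm M\in\mathbb R^{n\times n}$ be symmetric positive semidefinite, written $\mathrm M=\mathrm B^{\intercal}\mathrm B$ with $\mathrm B\in\mathbb R^{r\times n}$, $r\le n$. Standing assumption: $\mathcal K$ is nonempty and bounded, and $x\mapsto-\frac12x^{\intercal}\mathrm Mx+c^{\intercal}x$ is nonconstant on $\mathcal K$. Entropy: $\mathsf H(x)=-\sum_{i=1}^nx_i\log x_i$ if $x\ge0$ (with $0\log 0=0$), and $\mathsf H(x)=-\infty$ otherwise. $R_{\mathsf H}=\max_{x,x'\in\mathcal K}\{\mathsf H(x)-\mathsf H(x')\}$, $R_1=\max_{x\in\mathcal K}\|x\|_1$. $\mathcal V(\mathcal K)=\{v^{(i)}\}_{i=1}^V$ is the set of vertices of $\mathcal K$, $[V]=\{1,\dots,V\}$, and $\mathcal C_i=\{u\in\mathbb R^r:(c-\mathrm B^{\intercal}u)^{\intercal}v^{(i)}\le(c-\mathrm B^{\intercal}u)^{\intercal}v^{(j)}\text{ for every }j\ne i\}$. $g_0(u)=\frac12\|u\|^2+\min_{x\in\mathcal K}(c-\mathrm B^{\intercal}u)^{\intercal}x$,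 $u\in\mathbb R^r$. For $d\in\mathbb R^n$: $\mathcal O_d=\operatorname{argmin}_{x\in\mathcal K}d^{\intercal}x$ and $\kappa_d=\min_{x\in\mathcal V(\mathcal K)\setminus\mathcal O_d}d^{\intercal}x-\min_{x\in\mathcal O_d}d^{\intercal}x$. $\|\cdot\|$ is the Euclidean norm, $\|\cdot\|_{\mathrm{op}}$ the operator norm, $\operatorname{dist}(z,\mathcal C)=\inf_{z'\in\mathcal C}\|z-z'\|$, $\operatorname{bd}$ denotes boundary. Minima/infima over empty sets are $+\infty$. *)

(* Defs.v *)
From HB Require Import structures.
From mathcomp Require Import all_boot all_order all_algebra.
From mathcomp Require Import all_classical all_reals all_analysis.

Set Implicit Arguments.
Unset Strict Implicit.
Unset Printing Implicit Defensive.
Import Order.TTheory GRing.Theory Num.Theory.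
Import numFieldNormedType.Exports.

Local Open Scope classical_set_scope.
Local Open Scope ring_scope.

(* A minimum over a possibly empty set, or of extended-real values, is written
   as ereal_inf, so that a minimum over the empty set is +oo. Minima and maxima
   of continuous real functions over a nonempty compact set are written with
   the real-valued inf and sup. *)

Definition dot (R : realType) (n : nat) (x y : 'cV[R]_n) : R :=
  (x^T *m y) 0 0.

(* The library norm on matrices is the sup norm. *)
Definition norm1 (R : realType) (n : nat) (x : 'cV[R]_n) : R :=
  \sum_(i < n) `|x i 0|.

Definition norm2 (R : realType) (n : nat) (x : 'cV[R]_n) : R :=
  Num.sqrt (\sum_(i < n) x i 0 ^+ 2).

Definition opnorm (R : realType) (m n : nat) (A : 'M[R]_(m, n)) : R :=
  sup [set norm2 (A *m x) | x in [set x | norm2 x <= 1]].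

Definition dist (R : realType) (n : nat) (z : 'cV[R]_n) (C : set 'cV[R]_n) :
  \bar R := ereal_inf [set (norm2 (z - z'))%:E | z' in C].

Definition boundary (T : topologicalType) (C : set T) : set T :=
  closure C `\` interior C.

Definition argmin (T : Type) (disp : Order.disp_t) (U : porderType disp)
    (S : set T) (f : T -> U) : set T :=
  [set x | S x /\ forall y, S y -> (f x <= f y)%O].

Definition polyhedron (R : realType) (m n : nat)
    (A : 'M[R]_(m, n)) (b : 'cV[R]_m) : set 'cV[R]_n :=
  [set x | A *m x = b /\ forall i, 0 <= x i 0].

(* Vertices are the extreme points. *)
Definition vertices (R : realType) (n : nat) (K : set 'cV[R]_n) :
    set 'cV[R]_n :=
  [set v | K v /\ forall (x y : 'cV[R]_n) (t : R), K x -> K y -> 0 < t < 1 ->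
    v = t *: x + (1 - t) *: y -> x = v /\ y = v].

Definition entropy (R : realType) (n : nat) (x : 'cV[R]_n) : \bar R :=
  if [forall i, 0 <= x i 0] then (- \sum_(i < n) x i 0 * ln (x i 0))%:E
  else -oo%E.

Definition entropy_range (R : realType) (n : nat) (K : set 'cV[R]_n) : \bar R :=
  ereal_sup [set (entropy x - entropy x')%E | x in K & x' in K].

Definition radius1 (R : realType) (n : nat) (K : set 'cV[R]_n) : R :=
  sup [set norm1 x | x in K].

Definition quad_obj (R : realType) (n : nat) (M : 'M[R]_n) (c x : 'cV[R]_n) :
  R := - 2^-1 * dot x (M *m x) + dot c x.

Definition entropic_obj (R : realType) (n : nat) (M : 'M[R]_n) (c : 'cV[R]_n)
    (eps : R) (x : 'cV[R]_n) : \bar R :=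
  ((quad_obj M c x)%:E - eps%:E * entropy x)%E.

Definition g0 (R : realType) (n r : nat) (K : set 'cV[R]_n)
    (B : 'M[R]_(r, n)) (c : 'cV[R]_n) (u : 'cV[R]_r) : R :=
  2^-1 * norm2 u ^+ 2 + inf [set dot (c - B^T *m u) x | x in K].

Definition kappa (R : realType) (n : nat) (K : set 'cV[R]_n) (d : 'cV[R]_n) :
    \bar R :=
  let Od := argmin K (dot d) in
  (ereal_inf [set (dot d x)%:E | x in vertices K `\` Od]
   - ereal_inf [set (dot d x)%:E | x in Od])%E.

Definition cell (R : realType) (n r V : nat) (B : 'M[R]_(r, n)) (c : 'cV[R]_n)
    (v : 'I_V -> 'cV[R]_n) (i : 'I_V) : set 'cV[R]_r :=
  [set u | forall j, j != i ->
    dot (c - B^T *m u) (v i) <= dot (c - B^T *m u) (v j)].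

Definition Istar (R : realType) (n r V : nat) (K : set 'cV[R]_n)
    (B : 'M[R]_(r, n)) (c : 'cV[R]_n) (v : 'I_V -> 'cV[R]_n) : set 'I_V :=
  [set i | cell B c v i `&` argmin setT (g0 K B c) !=set0].

Definition alpha (R : realType) (n r V : nat) (K : set 'cV[R]_n)
    (B : 'M[R]_(r, n)) (c : 'cV[R]_n) (v : 'I_V -> 'cV[R]_n) : \bar R :=
  (ereal_inf [set (g0 K B c u)%:E
             | u in \bigcup_(i in ~` Istar K B c v) cell B c v i]
   - ereal_inf [set (g0 K B c u)%:E | u in setT])%E.

Definition gamma_at (R : realType) (n r V : nat)
    (B : 'M[R]_(r, n)) (c : 'cV[R]_n) (v : 'I_V -> 'cV[R]_n) (i : 'I_V) :
    \bar R :=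
  dist (B *m v i) (boundary (cell B c v i)).

Definition Delta_at (R : realType) (n r V : nat) (K : set 'cV[R]_n)
    (B : 'M[R]_(r, n)) (c : 'cV[R]_n) (v : 'I_V -> 'cV[R]_n) (i : 'I_V) :
    \bar R :=
  Order.min (kappa K (c - B^T *m (B *m v i)))
    (gamma_at B c v i / 2%:E
     * ereal_inf [set (norm2 (B *m v k - B *m v i))%:E
                 | k in [set k | B *m v k <> B *m v i]])%E.

Definition gamma (R : realType) (n r V : nat) (K : set 'cV[R]_n)
    (B : 'M[R]_(r, n)) (c : 'cV[R]_n) (v : 'I_V -> 'cV[R]_n) : \bar R :=
  ereal_inf [set gamma_at B c v i | i in Istar K B c v].

Definition Delta (R : realType) (n r V : nat) (K : set 'cV[R]_n)
    (B : 'M[R]_(r, n)) (c : 'cV[R]_n) (v : 'I_V -> 'cV[R]_n) : \bar R :=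
  ereal_inf [set Delta_at K B c v i | i in Istar K B c v].

(* Main.v *)
Require Import Defs.
From HB Require Import structures.
From mathcomp Require Import all_boot all_order all_algebra.
From mathcomp Require Import all_classical all_reals all_analysis.
From mathcomp Require Import ring lra.
Import Order.TTheory GRing.Theory Num.Theory.
Import numFieldNormedType.Exports.
Local Open Scope classical_set_scope.
Local Open Scope ring_scope.

(** Write [f = quad_obj M c] and let [x] be a minimizer of the entropic problem.

    Completing the square ([quad_obj_square]) gives, for every [u],
      [f x = 2^-1 |u|^2 + (c - B^T u) . x - 2^-1 |u - B x|^2],
    so the concave objective lies below affine functions, with equality for
    [u = B x]. Minimizing over [x] turns the upper bound into the dual function
    [g0], which on the cell of a vertex [v i] equals
    [f (v i) + 2^-1 |u - B (v i)|^2] ([g0_cell]); its minimum is that of [f].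

    Put [u = B x]. Comparing [x] with an optimal vertex shows that [g0 u]
    exceeds the minimum by at most [eps * RH]. As this is less than [alpha],
    the cell containing [u] belongs to some [v i] with [i] in [Istar]
    ([lt_alpha_Istar]). For such an [i] the vertex is optimal and [B (v i)] lies
    in its own cell ([Istar_optimal]), so that [|u - B (v i)|^2 <= 2 eps RH],
    and [u] is closer to [B (v i)] than half of the distance to the boundary of
    the cell. There every vertex whose cost [(c - B^T u) . v k] does not tie
    identically with that of [v i] costs at least [Delta] more ([Delta_gap]):
    the kappa term handles vertices with the same image under [B], and the room
    left inside the cell handles the others.

    By concavity of [f], [x] also minimizes the linear program with cost
    [c - B^T u] penalized by the entropy. Split [x = (1 - t) y + t z] with [y] a
    mixture of the tying vertices, at which [f] takes its minimum, and [z] a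
    mixture of the others ([polyhedron_split], which rests on Minkowski's
    theorem [vertex_ind]). Optimality of [x] among nearby points of the segment
    from [y] to [z] bounds the mass [t] by [expR (- Delta / (eps R1) + RH / R1)]
    ([entropic_segment_bound]). Finally [f x - f y <= t (c - M y) . (z - y)],
    which is at most [2 t (R1^2 |M| + |c| R1)] by Cauchy-Schwarz.

    This bound on [t] is smaller by a factor [expR 1] than the one obtained by
    comparing values at the two ends of the segment; the constant
    [K = max (4 R1^2 |M|) (2 |c| R1)] is thereby reached
    ([suboptimality_constant]). *)

Set Implicit Arguments.
Unset Strict Implicit.

(** * Inner products and norms *)

Lemma dotE (R : realType) (n : nat) (x y : 'cV[R]_n) :
  dot x y = \sum_i x i 0 * y i 0.
Proof. by rewrite /dot mxE; apply: eq_bigr => i _; rewrite mxE. Qed.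

Lemma dotC (R : realType) (n : nat) (x y : 'cV[R]_n) : dot x y = dot y x.
Proof. by rewrite !dotE; apply: eq_bigr => i _; rewrite mulrC. Qed.

Lemma dotDr (R : realType) (n : nat) (d x y : 'cV[R]_n) :
  dot d (x + y) = dot d x + dot d y.
Proof. by rewrite /dot mulmxDr mxE. Qed.

Lemma dotZr (R : realType) (n : nat) (d x : 'cV[R]_n) (a : R) :
  dot d (a *: x) = a * dot d x.
Proof. by rewrite /dot -scalemxAr mxE. Qed.

Lemma dotBr (R : realType) (n : nat) (d x y : 'cV[R]_n) :
  dot d (x - y) = dot d x - dot d y.
Proof. by rewrite -scaleN1r dotDr dotZr mulN1r. Qed.

Lemma dotDl (R : realType) (n : nat) (d x y : 'cV[R]_n) :
  dot (x + y) d = dot x d + dot y d.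
Proof. by rewrite dotC dotDr !(dotC d). Qed.

Lemma dotBl (R : realType) (n : nat) (d x y : 'cV[R]_n) :
  dot (x - y) d = dot x d - dot y d.
Proof. by rewrite dotC dotBr !(dotC d). Qed.

Lemma dotZl (R : realType) (n : nat) (d x : 'cV[R]_n) (a : R) :
  dot (a *: x) d = a * dot x d.
Proof. by rewrite dotC dotZr dotC. Qed.

Lemma dot_sumr (R : realType) (n : nat) (I : finType) (P : pred I)
    (d : 'cV[R]_n) (F : I -> 'cV[R]_n) :
  dot d (\sum_(k | P k) F k) = \sum_(k | P k) dot d (F k).
Proof. by rewrite /dot mulmx_sumr summxE. Qed.

Lemma dot_trmx (R : realType) (n r : nat) (B : 'M[R]_(r, n)) (u : 'cV[R]_r)
    (x : 'cV[R]_n) :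
  dot (B^T *m u) x = dot u (B *m x).
Proof. by rewrite /dot trmx_mul trmxK mulmxA. Qed.

Lemma mulmx_dot (R : realType) (m n : nat) (A : 'M[R]_(m, n)) (x : 'cV[R]_n)
    (i : 'I_m) :
  (A *m x) i 0 = dot (row i A)^T x.
Proof. by rewrite /dot trmxK -row_mul [in RHS]mxE. Qed.

Lemma dot_ge0 (R : realType) (n : nat) (x : 'cV[R]_n) : 0 <= dot x x.
Proof. by rewrite dotE sumr_ge0// => i _; rewrite -expr2 sqr_ge0. Qed.

Lemma dot_eq0 (R : realType) (n : nat) (x : 'cV[R]_n) :
  dot x x = 0 -> x = 0.
Proof.
rewrite dotE => /eqP; rewrite psumr_eq0; last first.
  by move=> i _; rewrite -expr2 sqr_ge0.
move=> /allP x0; apply/colP => i; rewrite mxE.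
by have := x0 i (mem_index_enum _); rewrite mulf_eq0 orbb => /eqP.
Qed.

Lemma norm2_ge0 (R : realType) (n : nat) (x : 'cV[R]_n) : 0 <= norm2 x.
Proof. exact: sqrtr_ge0. Qed.

Lemma norm2_sqr (R : realType) (n : nat) (x : 'cV[R]_n) :
  norm2 x ^+ 2 = dot x x.
Proof.
rewrite /norm2 sqr_sqrtr; last by rewrite sumr_ge0// => i _; rewrite sqr_ge0.
by rewrite dotE; apply: eq_bigr => i _; rewrite expr2.
Qed.

Lemma norm2Z (R : realType) (n : nat) (a : R) (x : 'cV[R]_n) :
  norm2 (a *: x) = `|a| * norm2 x.
Proof.
apply/eqP; rewrite -(eqrXn2 (n := 2))// ?mulr_ge0 ?norm2_ge0//.
by rewrite exprMn !norm2_sqr dotZl dotZr real_normK ?num_real// mulrA expr2.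
Qed.

Lemma norm2_0 (R : realType) (n : nat) : norm2 (0 : 'cV[R]_n) = 0.
Proof. by rewrite -(scale0r 0) norm2Z normr0 mul0r. Qed.

Lemma norm2N (R : realType) (n : nat) (x : 'cV[R]_n) : norm2 (- x) = norm2 x.
Proof. by rewrite -scaleN1r norm2Z normrN normr1 mul1r. Qed.

Lemma norm2_gt0 (R : realType) (n : nat) (x : 'cV[R]_n) :
  x <> 0 -> 0 < norm2 x.
Proof.
move=> x0; rewrite lt_def norm2_ge0 andbT; apply/eqP => nx0.
by apply: x0; apply: dot_eq0; rewrite -norm2_sqr nx0 expr0n.
Qed.

(** The square of [norm2 y *: x - norm2 x *: y] is nonnegative. *)
Lemma cauchy_schwarz (R : realType) (n : nat) (x y : 'cV[R]_n) :
  dot x y <= norm2 x * norm2 y.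
Proof.
have [x0|/norm2_gt0 x_gt0] := pselect (x = 0).
  by rewrite x0 dotE big1 ?mulr_ge0 ?norm2_ge0// => i _; rewrite mxE mul0r.
have [y0|/norm2_gt0 y_gt0] := pselect (y = 0).
  by rewrite y0 dotE big1 ?mulr_ge0 ?norm2_ge0// => i _; rewrite mxE mulr0.
have := dot_ge0 (norm2 y *: x - norm2 x *: y).
rewrite !(dotBl, dotBr, dotZl, dotZr) -!norm2_sqr (dotC y x) => h.
have xy_gt0 : 0 < norm2 x * norm2 y by rewrite mulr_gt0.
rewrite -(ler_pM2l xy_gt0); lra.
Qed.

Lemma norm2D (R : realType) (n : nat) (x y : 'cV[R]_n) :
  norm2 (x + y) <= norm2 x + norm2 y.
Proof.
rewrite -(ler_pXn2r (n := 2))// ?nnegrE ?addr_ge0 ?norm2_ge0//.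
rewrite sqrrD !norm2_sqr dotDl !dotDr (dotC y x).
have := cauchy_schwarz x y; lra.
Qed.

Lemma norm1_ge0 (R : realType) (n : nat) (x : 'cV[R]_n) : 0 <= norm1 x.
Proof. exact: sumr_ge0. Qed.

Lemma norm2_le_norm1 (R : realType) (n : nat) (x : 'cV[R]_n) :
  norm2 x <= norm1 x.
Proof.
rewrite -(ler_pXn2r (n := 2))// ?nnegrE ?norm1_ge0 ?norm2_ge0//.
rewrite norm2_sqr dotE expr2 {2}/norm1 mulr_sumr; apply: ler_sum => i _.
rewrite (le_trans (ler_norm _))// normrM ler_wpM2r//.
by rewrite /norm1 (bigD1 i)//= lerDl sumr_ge0.
Qed.

Lemma norm1_eqsum (R : realType) (n : nat) (x : 'cV[R]_n) :
  (forall i, 0 <= x i 0) -> norm1 x = \sum_i x i 0.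
Proof. by move=> x0; apply: eq_bigr => i _; rewrite ger0_norm. Qed.

(** By Cauchy-Schwarz the i-th coordinate of the product is at most the norm
    of the i-th row of the matrix; this is what makes the set defining
    [opnorm] bounded. *)
Lemma opnorm_has_ubound (R : realType) (m n : nat) (A : 'M[R]_(m, n)) :
  has_ubound [set norm2 (A *m x) | x in [set x | norm2 x <= 1]].
Proof.
exists (\sum_i norm2 (row i A)^T) => _ [x /= x1 <-].
apply: (le_trans (norm2_le_norm1 _)); apply: ler_sum => i _.
rewrite mulmx_dot -[leRHS]mulr1.
apply: (@le_trans _ _ (norm2 (row i A)^T * norm2 x)).
  rewrite ler_norml cauchy_schwarz andbT lerNl -mulN1r -dotZl scaleN1r.
  by rewrite -[norm2 _^T]norm2N cauchy_schwarz.
by rewrite ler_wpM2l ?norm2_ge0.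
Qed.

Lemma opnorm_ge0 (R : realType) (m n : nat) (A : 'M[R]_(m, n)) : 0 <= opnorm A.
Proof.
apply: (ub_le_sup (opnorm_has_ubound A)); exists 0 => /=.
  by rewrite norm2_0.
by rewrite mulmx0 norm2_0.
Qed.

Lemma norm2_mulmx_le (R : realType) (m n : nat) (A : 'M[R]_(m, n))
    (x : 'cV[R]_n) :
  norm2 (A *m x) <= opnorm A * norm2 x.
Proof.
have [->|/norm2_gt0 x_gt0] := pselect (x = 0).
  by rewrite mulmx0 !norm2_0 mulr0.
rewrite -ler_pdivrMr// mulrC; apply: (ub_le_sup (opnorm_has_ubound A)).
exists ((norm2 x)^-1 *: x) => /=.
  by rewrite norm2Z gtr0_norm ?invr_gt0// mulVf ?gt_eqF.
by rewrite -scalemxAr norm2Z gtr0_norm ?invr_gt0.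
Qed.

(** * The entropy *)

Definition real_entropy (R : realType) (n : nat) (x : 'cV[R]_n) : R :=
  - \sum_(i < n) x i 0 * ln (x i 0).

Lemma entropyE (R : realType) (n : nat) (x : 'cV[R]_n) :
  (forall i, 0 <= x i 0) -> entropy x = (real_entropy x)%:E.
Proof. by move=> /forallP x0; rewrite /entropy x0. Qed.

(** Gibbs' inequality in one coordinate: [ln (w / z) <= w / z - 1], with
    the convention that [0 ln 0 = 0]. *)
Lemma mul_ln_le (R : realType) (z w : R) :
  0 <= z -> 0 < w -> z * ln w <= z * ln z + w - z.
Proof.
rewrite le_eqVlt => /predU1P[<- w0|z0 w0]; first by lra.
have : ln (w / z) <= w / z - 1.
  have -> : w / z = 1 + (w / z - 1) by ring.
  by rewrite (le_trans (le_ln1Dx _))//; have := divr_gt0 w0 z0; lra.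
rewrite ln_div ?posrE// => h.
have : z * (ln w - ln z) <= z * (w / z - 1) by rewrite ler_wpM2l// ltW.
have -> : z * (w / z - 1) = w - z by field; rewrite gt_eqF.
lra.
Qed.

(** Write [w] and [z] for the points of the segment from [x] to [y] at
    parameters [s] and [t]. By concavity the increment of [- a ln a] from [w]
    to [z] is at most [z - w] times the slope at [w]; this slope term is then
    bounded by using [w >= s * y] in the term with [y], and Gibbs'
    inequality in the term with [x]. *)
Lemma entropy1_chord (R : realType) (x y s t : R) :
  0 <= x -> 0 <= y -> 0 < s -> s < t -> t <= 1 ->
  - (((1 - t) * x + t * y) * ln ((1 - t) * x + t * y))
    + ((1 - s) * x + s * y) * ln ((1 - s) * x + s * y) <=
    (t - s) * (- (y * ln y) + x * ln x - y * ln s + (1 - s) * (x - y)).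
Proof.
move=> x0 y0 s0 st t1; set z := (1 - t) * x + _; set w := (1 - s) * x + _.
have s1 : 0 < 1 - s by lra.
have xs0 : 0 <= (1 - s) * x by rewrite mulr_ge0// ltW.
have ys0 : 0 <= s * y by rewrite mulr_ge0// ltW.
have z0 : 0 <= z by rewrite addr_ge0// mulr_ge0//; lra.
have : 0 <= w by rewrite addr_ge0.
rewrite le_eqVlt => /predU1P[w0|w0].
  have /eqP : (1 - s) * x = 0 by rewrite /w in w0; lra.
  rewrite mulf_eq0 gt_eqF//= => /eqP x00.
  have /eqP : s * y = 0 by rewrite /w in w0; lra.
  rewrite mulf_eq0 gt_eqF//= => /eqP y00.
  by rewrite /z /w x00 y00 !mulr0 addr0 !mul0r subrr; lra.
have y_ln : - (y * ln w) <= - (y * ln y) - y * ln s.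
  move: y0; rewrite le_eqVlt => /predU1P[<-|y0]; first by lra.
  have : ln (s * y) <= ln w.
    by rewrite ler_ln ?posrE ?mulr_gt0// /w; lra.
  by rewrite lnM ?posrE// -(ler_pM2l y0) => h; lra.
have x_ln := mul_ln_le x0 w0.
have z_ln := mul_ln_le z0 w0.
have slope : x * ln w - y * ln w + x - y <=
    - (y * ln y) + x * ln x - y * ln s + (1 - s) * (x - y).
  rewrite /w in x_ln y_ln *; lra.
have ts0 : 0 <= t - s by lra.
apply: le_trans (ler_wpM2l ts0 slope).
have -> : (t - s) * (x * ln w - y * ln w + x - y) = (w - z) * ln w + (w - z).
  rewrite [in RHS]/w /z; set l := ln w; ring.
lra.
Qed.

Lemma entropy_chord (R : realType) (n : nat) (x y : 'cV[R]_n) (s t : R) :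
  (forall i, 0 <= x i 0) -> (forall i, 0 <= y i 0) ->
  0 < s -> s < t -> t <= 1 ->
  real_entropy ((1 - t) *: x + t *: y) - real_entropy ((1 - s) *: x + s *: y)
  <= (t - s) * (real_entropy y - real_entropy x - norm1 y * ln s
                + (1 - s) * (norm1 x - norm1 y)).
Proof.
move=> x0 y0 s0 st t1; rewrite !norm1_eqsum// /real_entropy.
rewrite !opprK -sumrB mulr_suml mulr_sumr -!sumrN -!big_split/=.
rewrite mulr_sumr; apply: ler_sum => i _.
have := entropy1_chord (x0 i) (y0 i) s0 st t1.
by rewrite !mxE /=; lra.
Qed.

(** The entropic minimizer over a segment from [x] towards [y], along which
    the linear cost grows with slope at least [kap], lies exponentially close
    to [x]. Comparing the minimizer with a point at parameter [s < t] gives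
    [kap <= eps * (RH + norm1 y * l + (1 - s) * (norm1 x - norm1 y))] where
    [l = - ln s]. The last term is at most [R1 - norm1 y], so if [l > 1] the
    bracket is at most [RH + R1 * l], whereas if [l <= 1] it is at most
    [RH + R1], which the hypothesis on [eps] excludes. Working with slopes
    rather than with values at [0] and [t] saves a factor [expR 1]. *)
Lemma entropic_segment_bound (R : realType) (n : nat) (x y d : 'cV[R]_n)
    (t eps kap R1 RH : R) :
  (forall i, 0 <= x i 0) -> (forall i, 0 <= y i 0) ->
  0 < t <= 1 -> 0 < eps -> 0 < R1 -> norm1 x <= R1 -> norm1 y <= R1 ->
  real_entropy y - real_entropy x <= RH ->
  kap <= dot d (y - x) -> eps * (R1 + RH) < kap ->
  let z s := (1 - s) *: x + s *: y in
  (forall s, 0 < s < t -> dot d (z t) - eps * real_entropy (z t) <=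
                          dot d (z s) - eps * real_entropy (z s)) ->
  t <= expR (- kap / (eps * R1) + RH / R1).
Proof.
move=> x0 y0 /andP[t0 t1] eps0 R10 xR1 yR1 HRH kapd kap_big z zmin.
rewrite leNgt; apply/negP; set E := expR _ => Et.
set Q := kap / (eps * R1) - RH / R1.
have EQ : E = expR (- Q) by rewrite /E /Q; congr expR; lra.
have E0 : 0 < E by exact: expR_gt0.
(* Any point strictly between [E] and [t] serves for the comparison. *)
pose s := (E + t) / 2.
have [s0 st Es] : [/\ 0 < s, s < t & E < s] by rewrite /s; split; lra.
have QE : R1 * Q = kap / eps - RH by rewrite /Q; field; rewrite !gt_eqF.
have kapE : R1 + RH < kap / eps by rewrite ltr_pdivlMr// mulrC.
have Q1 : 1 < Q by rewrite -(ltr_pM2l R10); lra.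
have lnQ : - ln s < Q.
  by rewrite ltrNl -ltr_expR lnK ?posrE// -EQ.
have ln0 : 0 < - ln s by rewrite oppr_gt0 ln_lt0// s0; lra.
have := zmin s; rewrite s0 st => /(_ isT).
have dz p : dot d (z p) = dot d x + p * dot d (y - x).
  by rewrite /z /= !(dotBr, dotDr, dotZr); ring.
rewrite !dz => zs.
have chord := entropy_chord x0 y0 s0 st t1.
rewrite -!/(z _) in chord.
set slope := (X in _ <= _ * X) in chord.
have ts0 : 0 < t - s by lra.
have : (t - s) * dot d (y - x) <= (t - s) * (eps * slope).
  have := ler_wpM2l (ltW eps0) chord; lra.
rewrite ler_pM2l// => d_slope.
have : kap / eps <= slope.
  by rewrite ler_pdivrMr// [leRHS]mulrC; exact: le_trans d_slope.
rewrite /slope; set l := ln s in lnQ ln0 *; set X := norm1 x in xR1 *.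
set Y := norm1 y in yR1 *.
have Y0 : 0 <= Y by exact: norm1_ge0.
have lt_R1 : R1 * - l < R1 * Q by rewrite ltr_pM2l.
move=> kap_le.
have main : R1 * Q <= Y * - l + (1 - s) * (X - Y) by lra.
have : (1 - s) * (X - Y) <= (1 - s) * (R1 - Y) by rewrite ler_wpM2l//; lra.
have : 0 <= s * (R1 - Y) by rewrite mulr_ge0//; lra.
have [l1|l1] := leP (- l) 1.
  have : Y * - l <= Y * 1 by rewrite ler_wpM2l.
  have : R1 * 1 < R1 * Q by rewrite ltr_pM2l.
  lra.
have : Y * (- l - 1) <= R1 * (- l - 1) by rewrite ler_wpM2r//; lra.
lra.
Qed.

(** * Bounded polyhedra and their vertices *)

Lemma polyhedron_conv (R : realType) (m n : nat) (A : 'M[R]_(m, n))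
    (b : 'cV[R]_m) (x y : 'cV[R]_n) (t : R) :
  polyhedron A b x -> polyhedron A b y -> 0 <= t <= 1 ->
  polyhedron A b (t *: x + (1 - t) *: y).
Proof.
move=> [Ax x0] [Ay y0] /andP[t0 t1]; split=> /= [|i].
  by rewrite mulmxDr -!scalemxAr Ax Ay -scalerDl addrC subrK scale1r.
by rewrite !mxE addr_ge0// mulr_ge0//; lra.
Qed.

Lemma bounded_set_coord (R : realType) (n : nat) (K : set 'cV[R]_n) :
  bounded_set K -> exists N : R, forall x, K x -> forall i, `|x i 0| <= N.
Proof.
move=> [N [_ KN]]; exists (N + 1) => x Kx i.
have : `|x| <= N + 1 by apply: KN => //; rewrite ltrDl.
apply: le_trans.
rewrite -[leRHS]/(mx_norm x) mx_normrE.
by rewrite (le_bigmax _ (fun ij => `|x ij.1 ij.2|) (i, 0)).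
Qed.

Definition support_size (R : realType) (n : nat) (x : 'cV[R]_n) : nat :=
  #|[pred i | x i 0 != 0]|.

(** Since the ray is unbounded and [A *m w = 0], it can only leave the
    polyhedron through a nonnegativity constraint. At the first one that it
    meets, a coordinate vanishes, while the coordinates that vanish at [x] do
    so along the whole ray. *)
Lemma polyhedron_ray_exit (R : realType) (m n : nat) (A : 'M[R]_(m, n))
    (b : 'cV[R]_m) (x w : 'cV[R]_n) :
  bounded_set (polyhedron A b) -> polyhedron A b x -> A *m w = 0 -> w <> 0 ->
  (forall i, x i 0 = 0 -> w i 0 = 0) ->
  exists s, [/\ 0 < s, polyhedron A b (x + s *: w) &
                (support_size (x + s *: w) < support_size x)%N].
Proof.
move=> /bounded_set_coord[N KN] [Ax x0] Aw w_neq0 supp.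
have Axw s : A *m (x + s *: w) = b.
  by rewrite mulmxDr -scalemxAr Aw scaler0 addr0.
have [i0 wi0] : exists i, w i 0 < 0.
  apply: contrapT => /forallNP w_ge0; apply: w_neq0.
  have {}w_ge0 i : 0 <= w i 0 by rewrite leNgt; apply/negP/w_ge0.
  apply/colP => i; rewrite mxE; apply/eqP; rewrite eq_le w_ge0 andbT leNgt.
  apply/negP => wi0; have N0 : 0 <= N.
    by have := KN x (conj Ax x0) i; exact: le_trans (normr_ge0 _).
  pose s := (N + 1) / w i 0.
  have s0 : 0 <= s by rewrite divr_ge0 ?ltW//; lra.
  have : polyhedron A b (x + s *: w).
    by split=> // j; rewrite !mxE addr_ge0// mulr_ge0.
  move=> /KN /(_ i); rewrite !mxE /s divfK ?gt_eqF//.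
  move=> /(le_trans (ler_norm _)).
  by have := x0 i; lra.
have [i_ wi_ i_min] : exists2 i, w i 0 < 0 &
    forall j, w j 0 < 0 -> x i 0 / - w i 0 <= x j 0 / - w j 0.
  by case: (@Order.TotalTheory.arg_minP _ _ _ i0 (fun i => w i 0 < 0)
    (fun i => x i 0 / - w i 0) wi0) => i wi imin; exists i.
pose s := x i_ 0 / - w i_ 0.
have xi_ : 0 < x i_ 0.
  by rewrite lt_def x0 andbT; apply/eqP => /supp wi_0; rewrite wi_0 ltxx in wi_.
have s0 : 0 < s by rewrite divr_gt0// oppr_gt0.
exists s; split=> //.
  split=> // j; rewrite !mxE.
  have [wj|wj] := leP 0 (w j 0); first by rewrite addr_ge0// mulr_ge0// ltW.
  have := i_min j wj; rewrite -/s ler_pdivlMr ?oppr_gt0//; lra.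
apply/proper_card/properP; split.
  apply/fintype.subsetP => j; rewrite !inE; apply: contra => /eqP xj.
  rewrite !mxE.
  by rewrite xj (supp _ xj) mulr0 addr0 eqxx.
exists i_; first by rewrite inE gt_eqF.
by rewrite !inE negbK !mxE /s; apply/eqP; field; rewrite lt_eqF.
Qed.

(** Minkowski's theorem as an induction principle. A point that is not a
    vertex lies inside a segment of the polyhedron; extending this segment
    both ways until it exits writes the point as a convex combination of two
    points with smaller supports. *)
Lemma vertex_ind (R : realType) (m n : nat) (A : 'M[R]_(m, n)) (b : 'cV[R]_m)
    (P : 'cV[R]_n -> Prop) :
  bounded_set (polyhedron A b) ->
  (forall x y t, polyhedron A b x -> polyhedron A b y -> P x -> P y ->
    0 < t < 1 -> P (t *: x + (1 - t) *: y)) ->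
  (forall x, vertices (polyhedron A b) x -> P x) ->
  forall x, polyhedron A b x -> P x.
Proof.
move=> Kbd Pconv Pvert x; have [N] := ubnP (support_size x).
elim: N x => // N IH x xN Kx.
have [/Pvert//|x_nvert] := pselect (vertices (polyhedron A b) x).
have [y [z [t [Ky Kz t01 xE yz]]]] : exists y z t,
    [/\ polyhedron A b y, polyhedron A b z, 0 < t < 1,
        x = t *: y + (1 - t) *: z & y - z <> 0].
  apply: contrapT => H; apply: x_nvert; split=> // y z t Ky Kz t01 xE.
  have yz : y = z.
    apply: contrapT => yz; apply: H; exists y, z, t; split=> //.
    by move=> /eqP; rewrite subr_eq0 => /eqP.
  by rewrite xE -yz -scalerDl addrC subrK scale1r.
have Aw : A *m (y - z) = 0 by rewrite mulmxBr Ky.1 Kz.1 subrr.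
have supp i : x i 0 = 0 -> (y - z) i 0 = 0.
  move: t01 => /andP[t0 t1]; rewrite xE !mxE => /eqP.
  have := Ky.2 i; have := Kz.2 i => zi yi.
  rewrite paddr_eq0 ?mulr_ge0//; try lra.
  rewrite !mulf_eq0 (gt_eqF t0) (_ : (1 - t == 0) = false) /=.
    by move=> /andP[/eqP -> /eqP ->]; rewrite subrr.
  by rewrite gt_eqF//; lra.
have AwN : A *m - (y - z) = 0 by rewrite mulmxN Aw oppr0.
have suppN i : x i 0 = 0 -> (- (y - z)) i 0 = 0.
  by move=> /supp yzi; rewrite mxE yzi oppr0.
have yzN : - (y - z) <> 0 by move=> /eqP; rewrite oppr_eq0 => /eqP.
have [s [s0 Ks sN]] := polyhedron_ray_exit Kbd Kx Aw yz supp.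
have [q [q0 Kq qN]] := polyhedron_ray_exit Kbd Kx AwN yzN suppN.
have sq : s + q != 0 by rewrite gt_eqF// addr_gt0.
have -> : x = (q / (s + q)) *: (x + s *: (y - z))
          + (1 - q / (s + q)) *: (x + q *: - (y - z)).
  by apply/colP => i; rewrite !mxE; field.
apply: Pconv => //.
- by apply: IH => //; exact: leq_trans sN _.
- by apply: IH => //; exact: leq_trans qN _.
- by rewrite divr_gt0 ?addr_gt0//= ltr_pdivrMr ?addr_gt0// mul1r ltrDr.
Qed.

Lemma range_vertices_mem (R : realType) (n V : nat) (K : set 'cV[R]_n)
    (v : 'I_V -> 'cV[R]_n) (j : 'I_V) :
  range v = vertices K -> K (v j).
Proof.
by move=> v_vert; have [] : vertices K (v j) by rewrite -v_vert; exists j.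
Qed.

Lemma convex_combination_vertices (R : realType) (m n V : nat)
    (A : 'M[R]_(m, n)) (b : 'cV[R]_m) (v : 'I_V -> 'cV[R]_n) :
  bounded_set (polyhedron A b) -> range v = vertices (polyhedron A b) ->
  forall x, polyhedron A b x -> exists p : 'I_V -> R,
    [/\ forall k, 0 <= p k, \sum_k p k = 1 & x = \sum_k p k *: v k].
Proof.
move=> Kbd v_vert; apply: vertex_ind => //.
  move=> x y t Kx Ky [p [p0 p1 ->]] [q [q0 q1 ->]] /andP[t0 t1].
  exists (fun k => t * p k + (1 - t) * q k); split.
  - by move=> k; rewrite addr_ge0// mulr_ge0//; lra.
  - by rewrite big_split/= -!mulr_sumr p1 q1; lra.
  - rewrite !scaler_sumr -big_split/=; apply: eq_bigr => k _.
    by rewrite !scalerA -scalerDl.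
move=> x; rewrite -v_vert => -[k _ <-].
exists (fun j => (j == k)%:R); split=> [j||]; first exact: ler0n.
  by rewrite (bigD1 k)//= eqxx big1 ?addr0// => j /negbTE ->.
by rewrite (bigD1 k)//= eqxx scale1r big1 ?addr0// => j /negbTE ->;
  rewrite scale0r.
Qed.

Lemma polyhedron_barycenter (R : realType) (m n : nat) (A : 'M[R]_(m, n))
    (b : 'cV[R]_m) (I : finType) (P : pred I) (p : I -> R)
    (v : I -> 'cV[R]_n) :
  (forall k, 0 <= p k) -> (forall k, polyhedron A b (v k)) ->
  0 < \sum_(k | P k) p k ->
  polyhedron A b ((\sum_(k | P k) p k)^-1 *: \sum_(k | P k) p k *: v k).
Proof.
move=> p0 Kv s0; split=> [|i].
  rewrite -scalemxAr mulmx_sumr (eq_bigr (fun k => p k *: b)).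
    by rewrite -scaler_suml scalerA mulVf ?gt_eqF// scale1r.
  by move=> k _; rewrite -scalemxAr (Kv k).1.
rewrite mxE summxE; apply: mulr_ge0; first by rewrite invr_ge0 ltW.
apply: sumr_ge0 => k _.
by rewrite mxE mulr_ge0//; exact: (Kv k).2.
Qed.

(** * The quadratic objective and its dual function *)

Lemma dot_cost (R : realType) (n r : nat) (B : 'M[R]_(r, n)) (c x : 'cV[R]_n)
    (u : 'cV[R]_r) :
  dot (c - B^T *m u) x = dot c x - dot u (B *m x).
Proof. by rewrite dotBl dot_trmx. Qed.

(** For fixed [u] the last term measures the gap between the concave objective
    and an affine upper bound, which is tight when [u = B *m x]. *)
Lemma quad_obj_square (R : realType) (n r : nat) (B : 'M[R]_(r, n))
    (c x : 'cV[R]_n) (u : 'cV[R]_r) :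
  quad_obj (B^T *m B) c x =
  2^-1 * norm2 u ^+ 2 + dot (c - B^T *m u) x - 2^-1 * norm2 (u - B *m x) ^+ 2.
Proof.
rewrite /quad_obj -mulmxA dotC dot_trmx dot_cost !norm2_sqr !(dotBl, dotBr).
by rewrite (dotC u); field.
Qed.

Lemma quad_obj_le (R : realType) (n r : nat) (B : 'M[R]_(r, n))
    (c x : 'cV[R]_n) (u : 'cV[R]_r) :
  quad_obj (B^T *m B) c x <= 2^-1 * norm2 u ^+ 2 + dot (c - B^T *m u) x.
Proof.
by rewrite (quad_obj_square B c x u) gerBl mulr_ge0 ?invr_ge0 ?sqr_ge0.
Qed.

Lemma quad_obj_tight (R : realType) (n r : nat) (B : 'M[R]_(r, n))
    (c x : 'cV[R]_n) :
  quad_obj (B^T *m B) c x =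
  2^-1 * norm2 (B *m x) ^+ 2 + dot (c - B^T *m (B *m x)) x.
Proof.
rewrite (quad_obj_square B c x (B *m x)) subrr norm2_0.
by rewrite expr0n/= mulr0 subr0.
Qed.

Lemma linear_min_vertex (R : realType) (m n V : nat) (A : 'M[R]_(m, n))
    (b : 'cV[R]_m) (d : 'cV[R]_n) (v : 'I_V -> 'cV[R]_n) (a : R) :
  bounded_set (polyhedron A b) -> range v = vertices (polyhedron A b) ->
  (forall j, a <= dot d (v j)) ->
  forall x, polyhedron A b x -> a <= dot d x.
Proof.
move=> Kbd v_vert av; apply: vertex_ind => // [x y t _ _ ax ay /andP[t0 t1]|x].
  rewrite dotDr !dotZr.
  have : t * a <= t * dot d x by rewrite ler_wpM2l// ltW.
  have : (1 - t) * a <= (1 - t) * dot d y by rewrite ler_wpM2l//; lra.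
  lra.
by rewrite -v_vert => -[j _ <-].
Qed.

(** The affine upper bound that is tight at a convex combination of two points
    dominates the objective at both of them. *)
Lemma quad_obj_min_vertex (R : realType) (m n r V : nat) (A : 'M[R]_(m, n))
    (b : 'cV[R]_m) (B : 'M[R]_(r, n)) (c : 'cV[R]_n)
    (v : 'I_V -> 'cV[R]_n) (a : R) :
  bounded_set (polyhedron A b) -> range v = vertices (polyhedron A b) ->
  (forall j, a <= quad_obj (B^T *m B) c (v j)) ->
  forall x, polyhedron A b x -> a <= quad_obj (B^T *m B) c x.
Proof.
move=> Kbd v_vert av; apply: vertex_ind => // [x y t _ _ ax ay /andP[t0 t1]|x].
  rewrite quad_obj_tight; set u := B *m _.
  rewrite dotDr !dotZr; set C := 2^-1 * _.
  have := le_trans ax (quad_obj_le B c x u).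
  have := le_trans ay (quad_obj_le B c y u).
  rewrite -/C => Cy Cx.
  have : t * a <= t * (C + dot (c - B^T *m u) x) by rewrite ler_wpM2l// ltW.
  have : (1 - t) * a <= (1 - t) * (C + dot (c - B^T *m u) y).
    by rewrite ler_wpM2l//; lra.
  lra.
by rewrite -v_vert => -[j _ <-].
Qed.

Lemma inf_attained (R : realType) (T : Type) (S : set T) (f : T -> R) (x : T) :
  S x -> (forall y, S y -> f x <= f y) -> inf [set f y | y in S] = f x.
Proof.
move=> Sx fx; apply/eqP; rewrite eq_le; apply/andP; split.
  apply: ge_inf; last by exists x.
  by exists (f x) => _ [y Sy <-]; exact: fx.
by apply: lb_le_inf => [|_ [y Sy <-]]; [exists (f x), x|exact: fx].
Qed.

Lemma ereal_inf_attained (R : realType) (T : Type) (S : set T) (f : T -> R)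
    (x : T) :
  S x -> (forall y, S y -> f x <= f y) ->
  ereal_inf [set (f y)%:E | y in S] = (f x)%:E.
Proof.
move=> Sx fx; apply/eqP; rewrite eq_le; apply/andP; split.
  by apply: ereal_inf_lbound; exists x.
by apply: le_ereal_inf_tmp => _ [y Sy <-]; rewrite lee_fin; exact: fx.
Qed.

Lemma cell_le (R : realType) (n r V : nat) (B : 'M[R]_(r, n)) (c : 'cV[R]_n)
    (v : 'I_V -> 'cV[R]_n) (i j : 'I_V) (u : 'cV[R]_r) :
  cell B c v i u -> dot (c - B^T *m u) (v i) <= dot (c - B^T *m u) (v j).
Proof. by move=> ci; have [->//|/ci] := eqVneq j i. Qed.

Lemma g0_cell (R : realType) (m n r V : nat) (A : 'M[R]_(m, n))
    (b : 'cV[R]_m) (B : 'M[R]_(r, n)) (c : 'cV[R]_n)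
    (v : 'I_V -> 'cV[R]_n) (i : 'I_V) (u : 'cV[R]_r) :
  bounded_set (polyhedron A b) -> range v = vertices (polyhedron A b) ->
  cell B c v i u ->
  g0 (polyhedron A b) B c u =
  quad_obj (B^T *m B) c (v i) + 2^-1 * norm2 (u - B *m v i) ^+ 2.
Proof.
move=> Kbd v_vert ui; rewrite (quad_obj_square B c (v i) u) subrK /g0.
congr (_ + _); apply: inf_attained; first exact: range_vertices_mem.
by move=> x; apply: (linear_min_vertex Kbd v_vert) => j; exact: cell_le.
Qed.

Lemma exists_min_index (R : realType) (V : nat) (f : 'I_V -> R) (k : 'I_V) :
  exists i, forall j, f i <= f j.
Proof.
by case: (@Order.TotalTheory.arg_minP _ _ _ k xpredT f isT) => i _ fi;
  exists i => j; exact: fi.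
Qed.

(** * Compactness constants of a bounded polyhedron *)

Lemma radius1_ub (R : realType) (n : nat) (K : set 'cV[R]_n) (x : 'cV[R]_n) :
  bounded_set K -> K x -> norm1 x <= radius1 K.
Proof.
move=> /bounded_set_coord[N KN] Kx; apply: ub_le_sup; last by exists x.
exists (\sum_(i < n) N) => _ [y Ky <-]; apply: ler_sum => i _; exact: KN.
Qed.

(** Each term of the entropy lies in [[- N ^+ 2, 1]] when the coordinates lie
    in [[0, N]]. *)
Lemma entropy_range_fin (R : realType) (n : nat) (K : set 'cV[R]_n) :
  bounded_set K -> K !=set0 -> (forall x, K x -> forall i, 0 <= x i 0) ->
  exists rh : R, [/\ entropy_range K = rh%:E, 0 <= rh &
    forall x y, K x -> K y -> real_entropy x - real_entropy y <= rh].
Proof.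
move=> /bounded_set_coord[N KN] [x0 Kx0] K0.
have ubK x y : K x -> K y ->
    real_entropy x - real_entropy y <= \sum_(i < n) (1 + N ^+ 2).
  move=> Kx Ky; rewrite /real_entropy opprK addrC -sumrB.
  apply: ler_sum => i _; have xi := K0 x Kx i; have yi := K0 y Ky i.
  have x1 : - (x i 0 * ln (x i 0)) <= 1.
    by have := mul_ln_le xi ltr01; rewrite ln1 mulr0; lra.
  suff : y i 0 * ln (y i 0) <= N ^+ 2 by lra.
  have yN : y i 0 <= N by rewrite (le_trans (ler_norm _))//; exact: KN.
  apply: (@le_trans _ _ (y i 0 * y i 0)).
    move: yi; rewrite le_eqVlt => /predU1P[<-|yi]; first by rewrite !mul0r.
    by rewrite ler_pM2l// ltW// ln_sublinear.
  by rewrite expr2 ler_pM.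
have rangeE x y : K x -> K y ->
    (entropy x - entropy y)%E = (real_entropy x - real_entropy y)%:E.
  by move=> Kx Ky; rewrite !entropyE//; exact: K0.
have diff_le x y : K x -> K y ->
    ((real_entropy x - real_entropy y)%:E <= entropy_range K)%E.
  move=> Kx Ky; rewrite -rangeE//; apply: ereal_sup_ubound.
  by exists x => //; exists y.
have range_le : (entropy_range K <= (\sum_(i < n) (1 + N ^+ 2))%:E)%E.
  apply: ge_ereal_sup => _ [x Kx [y Ky <-]].
  by rewrite rangeE// lee_fin ubK.
have := diff_le x0 x0 Kx0 Kx0; rewrite subrr.
case: (entropy_range K) diff_le range_le => [rh| |]//= diff_le _ rh0.
by exists rh; split=> // x y Kx Ky; have := diff_le x y Kx Ky; rewrite lee_fin.
Qed.

(** * Distance to the boundary of a cell *)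

(** On the segment from a point of [C] to a point outside of [C], the
    supremum of the parameters at which the segment meets [C] is a boundary
    point. *)
Lemma segment_boundary (R : realType) (r : nat) (C : set 'cV[R]_r)
    (z0 z : 'cV[R]_r) :
  C z0 -> ~ C z ->
  exists2 z', boundary C z' & norm2 (z0 - z') <= norm2 (z0 - z).
Proof.
move=> Cz0 Cz; pose path (t : R) := z0 + t *: (z - z0).
have path_cont : continuous path.
  move=> t; apply: cvgD; first exact: cvg_cst.
  by apply: cvgZr_tmp; exact: cvg_id.
pose T := [set t | 0 <= t <= 1 /\ C (path t)].
have T0 : T 0 by rewrite /T/= lexx ler01 /path scale0r addr0.
have supT : has_sup T.
  by split; [exists 0|exists 1 => t [/andP[]]].
have ubT := ub_le_sup supT.2.
set s := sup T in ubT.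
have s0 : 0 <= s by exact: ubT.
have s1 : s <= 1 by apply: ge_sup => [|t [/andP[]]//]; exists 0.
exists (path s); last first.
  rewrite /path opprD addNKr norm2N norm2Z -[norm2 (z0 - z)]norm2N opprB.
  by rewrite ger0_norm// ler_piMl ?norm2_ge0.
split=> [U /path_cont|].
  move=> /nbhs_ballP[e /= e0 eU].
  have [t Tt st] := sup_adherent e0 supT.
  exists (path t); split; first by case: Tt.
  apply: eU; rewrite /ball/= ger0_norm; first by rewrite -/s in st; lra.
  by rewrite subr_ge0; exact: ubT.
move=> sC; have Cs := nbhs_singleton sC.
have s_lt1 : s < 1.
  rewrite lt_neqAle s1 andbT; apply/eqP => sE; apply: Cz.
  by move: Cs; rewrite sE /path scale1r addrC subrK.
have /path_cont/nbhs_ballP[e /= e0 eC] := sC.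
pose t := Num.min (s + e / 2) 1.
have st : s < t by rewrite /t lt_min s_lt1 andbT; lra.
suff : T t by move=> /ubT; rewrite leNgt st.
split; first by rewrite (le_trans s0 (ltW st)) /t ge_min lexx orbT.
apply: eC; rewrite /ball/= distrC ger0_norm; last by rewrite subr_ge0 ltW.
have : t <= s + e / 2 by rewrite /t ge_min lexx.
lra.
Qed.

Lemma cell_in_ball (R : realType) (n r V : nat) (B : 'M[R]_(r, n))
    (c : 'cV[R]_n) (v : 'I_V -> 'cV[R]_n) (i : 'I_V) (z : 'cV[R]_r) :
  cell B c v i (B *m v i) ->
  ((norm2 (B *m v i - z))%:E < gamma_at B c v i)%E -> cell B c v i z.
Proof.
move=> Ci; apply: contraPP => /(segment_boundary Ci)[z' bz' z'z].
apply/negP; rewrite -leNgt; apply: (@le_trans _ _ (norm2 (B *m v i - z'))%:E).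
  by apply: ereal_inf_lbound; exists z'.
by rewrite lee_fin.
Qed.

(** Moving from [u] by the length [s] in the direction in which the cost of
    the vertex [v k] decreases fastest relative to that of [v i] does not leave
    the cell. *)
Lemma cell_slope (R : realType) (n r V : nat) (B : 'M[R]_(r, n))
    (c : 'cV[R]_n) (v : 'I_V -> 'cV[R]_n) (i k : 'I_V) (u : 'cV[R]_r)
    (s : R) :
  cell B c v i (B *m v i) -> 0 <= s ->
  ((norm2 (u - B *m v i) + s)%:E < gamma_at B c v i)%E ->
  s * norm2 (B *m v k - B *m v i) <= dot (c - B^T *m u) (v k - v i).
Proof.
move=> Ci s0 sg.
have [->|/norm2_gt0] := pselect (B *m v k - B *m v i = 0).
  rewrite norm2_0 mulr0 dotBr subr_ge0.
  apply: cell_le; apply: cell_in_ball => //; apply: le_lt_trans sg.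
  by rewrite lee_fin -norm2N opprB lerDl.
set w := B *m v k - _ => w0; pose dir := (norm2 w)^-1 *: w.
have : cell B c v i (u + s *: dir).
  apply: cell_in_ball => //; apply: le_lt_trans sg.
  rewrite lee_fin -norm2N opprB addrAC (le_trans (norm2D _ _))// lerD2l.
  rewrite !norm2Z (ger0_norm s0) gtr0_norm ?invr_gt0//.
  by rewrite mulVf ?gt_eqF// mulr1.
move=> /cell_le => /(_ k); rewrite -subr_ge0 -dotBr !dot_cost mulmxBr -/w.
rewrite dotDl !dotZl -norm2_sqr.
have -> : (norm2 w)^-1 * norm2 w ^+ 2 = norm2 w by field; rewrite gt_eqF.
lra.
Qed.

(** [cell_slope] for [s] tending to half of the distance to the boundary. *)
Lemma cell_gap (R : realType) (n r V : nat) (B : 'M[R]_(r, n))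
    (c : 'cV[R]_n) (v : 'I_V -> 'cV[R]_n) (i k : 'I_V) (u : 'cV[R]_r) :
  cell B c v i (B *m v i) -> B *m v k <> B *m v i ->
  ((2 * norm2 (u - B *m v i))%:E < gamma_at B c v i)%E ->
  (gamma_at B c v i / 2%:E * (norm2 (B *m v k - B *m v i))%:E
   <= (dot (c - B^T *m u) (v k - v i))%:E)%E.
Proof.
move=> Ci Bki; have := @cell_slope _ _ _ _ B c v i k u _ Ci.
have : 0 < norm2 (B *m v k - B *m v i).
  by apply: norm2_gt0 => /eqP; rewrite subr_eq0 => /eqP.
set N := norm2 (B *m v k - _); set X := dot _ _; set del := norm2 _.
have del0 : 0 <= del by exact: norm2_ge0.
move=> N0; case: (gamma_at B c v i) => [g| |]//= slope.
  rewrite lte_fin inver pnatr_eq0/= -!EFinM lee_fin => delg.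
  rewrite leNgt; apply/negP => X_lt.
  have XN : X / N < g / 2 by rewrite ltr_pdivrMr.
  pose s := Num.max ((X / N + g / 2) / 2) 0.
  have : s * N <= X.
    apply: slope; first by rewrite /s le_max lexx orbT.
    rewrite lte_fin /s; have [] := leP ((X / N + g / 2) / 2) 0; lra.
  rewrite -ler_pdivlMr// leNgt /s lt_max.
  have -> // : X / N < (X / N + g / 2) / 2.
  lra.
move=> _; exfalso; have /slope := ltry (del + (`|X / N| + 1)).
have -> : 0 <= `|X / N| + 1 by rewrite addr_ge0.
move=> /(_ isT); rewrite -ler_pdivlMr//; have := ler_norm (X / N); lra.
Qed.

(** The vertices left out have the same cost as [v i] for every [u]. Among
    the others, those with the same image as [v i] under [B] have a relative
    cost that does not depend on [u], so that [kappa] at [B *m v i] bounds it;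
    the remaining ones are covered by [cell_gap]. *)
Lemma Delta_gap (R : realType) (m n r V : nat) (A : 'M[R]_(m, n))
    (b : 'cV[R]_m) (B : 'M[R]_(r, n)) (c : 'cV[R]_n)
    (v : 'I_V -> 'cV[R]_n) (i k : 'I_V) (u : 'cV[R]_r) :
  bounded_set (polyhedron A b) -> range v = vertices (polyhedron A b) ->
  cell B c v i (B *m v i) ->
  ((2 * norm2 (u - B *m v i))%:E < gamma_at B c v i)%E ->
  ~ (B *m v k = B *m v i /\ dot c (v k) = dot c (v i)) ->
  (Delta_at (polyhedron A b) B c v i
   <= (dot (c - B^T *m u) (v k - v i))%:E)%E.
Proof.
move=> Kbd v_vert Ci ug k_bad; rewrite /Delta_at.
have vK j : polyhedron A b (v j) by exact: range_vertices_mem.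
have [Bki|Bki] := pselect (B *m v k = B *m v i); last first.
  apply: le_trans (cell_gap Ci Bki ug); rewrite ge_min; apply/orP; right.
  apply: lee_wpmul2l.
    rewrite mule_ge0// ?inve_ge0 ?lee_fin//.
    by apply: le_trans (ltW ug); rewrite lee_fin mulr_ge0 ?norm2_ge0.
  by apply: ereal_inf_lbound; exists k.
rewrite ge_min; apply/orP; left; set d := c - B^T *m (B *m v i).
have i_opt : argmin (polyhedron A b) (dot d) (v i).
  split=> // x Kx; apply: (linear_min_vertex Kbd v_vert) Kx => j.
  exact: cell_le.
have dE : dot (c - B^T *m u) (v k - v i) = dot d (v k) - dot d (v i).
  by rewrite /d dotBr !dot_cost Bki; ring.
rewrite dE /kappa (ereal_inf_attained i_opt); last by move=> y [/i_opt.2].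
rewrite EFinB leeB//; apply: ereal_inf_lbound; exists (v k) => //; split.
  by rewrite -v_vert; exists k.
move=> k_opt; apply: k_bad; split=> //.
have : dot d (v k) = dot d (v i).
  by apply/eqP; rewrite eq_le k_opt.2// i_opt.2.
by rewrite /d !dot_cost Bki => /addIr.
Qed.

(** * Splitting a point between two families of vertices *)

Lemma dot_barycenter (R : realType) (n : nat) (I : finType) (P : pred I)
    (p : I -> R) (v : I -> 'cV[R]_n) (d : 'cV[R]_n) :
  dot d ((\sum_(k | P k) p k)^-1 *: \sum_(k | P k) p k *: v k) =
  (\sum_(k | P k) p k)^-1 * (\sum_(k | P k) p k * dot d (v k)).
Proof.
rewrite dotZr dot_sumr; congr (_ * _); apply: eq_bigr => k _.
exact: dotZr.
Qed.

(** Group the terms of a convex combination of vertices according to [P] and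
    normalize both parts; [v i] stands for the first one when it has no
    mass. *)
Lemma polyhedron_split (R : realType) (m n V : nat) (A : 'M[R]_(m, n))
    (b : 'cV[R]_m) (v : 'I_V -> 'cV[R]_n) (P : pred 'I_V) (i : 'I_V)
    (x : 'cV[R]_n) :
  bounded_set (polyhedron A b) -> range v = vertices (polyhedron A b) ->
  P i -> polyhedron A b x ->
  exists t y z,
    [/\ 0 <= t <= 1, polyhedron A b y, x = (1 - t) *: y + t *: z,
        forall d a, (forall k, P k -> dot d (v k) = a) -> dot d y = a &
        0 < t -> [/\ polyhedron A b z, exists k, ~~ P k &
          forall d a, (forall k, ~~ P k -> a <= dot d (v k)) -> a <= dot d z]].
Proof.
move=> Kbd v_vert Pi /(convex_combination_vertices Kbd v_vert)[p [p0 p1 xE]].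
have vK j : polyhedron A b (v j) by exact: range_vertices_mem.
rewrite (bigID P)/= in p1; rewrite (bigID P)/= in xE.
set u := \sum_(k | P k) p k in p1; set t := \sum_(k | ~~ P k) p k in p1.
have u0 : 0 <= u by exact: sumr_ge0.
have t0 : 0 <= t by exact: sumr_ge0.
have uE : 1 - t = u by lra.
have t1 : 0 <= t <= 1 by rewrite t0; lra.
have massless Q : \sum_(k | Q k) p k = 0 -> \sum_(k | Q k) p k *: v k = 0.
  move=> /eqP; rewrite psumr_eq0// => /allP pQ; apply: big1 => k Qk.
  by have := pQ k (mem_index_enum _); rewrite Qk => /eqP ->; rewrite scale0r.
have normalize Q : 0 < \sum_(k | Q k) p k ->
    \sum_(k | Q k) p k *: v k =
    (\sum_(k | Q k) p k) *:
      ((\sum_(k | Q k) p k)^-1 *: \sum_(k | Q k) p k *: v k).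
  by move=> s0; rewrite scalerA mulfV ?gt_eqF// scale1r.
have [y [Ky yE yP]] : exists y, [/\ polyhedron A b y,
    \sum_(k | P k) p k *: v k = u *: y &
    forall d a, (forall k, P k -> dot d (v k) = a) -> dot d y = a].
  move: u0; rewrite le_eqVlt => /predU1P[u0|u0].
    exists (v i); split=> //; last by move=> d a; apply.
    by rewrite -u0 scale0r massless.
  exists (u^-1 *: \sum_(k | P k) p k *: v k); split.
  - exact: polyhedron_barycenter.
  - exact: normalize.
  - move=> d a dv; rewrite dot_barycenter.
    have -> : \sum_(k | P k) p k * dot d (v k) = u * a.
      by rewrite mulr_suml; apply: eq_bigr => k Pk; rewrite dv.
    by rewrite mulrA mulVf ?gt_eqF// mul1r.
exists t, y, (t^-1 *: \sum_(k | ~~ P k) p k *: v k); split=> //.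
  rewrite xE yE uE; congr (_ + _).
  move: t0; rewrite le_eqVlt => /predU1P[t0|]; last exact: normalize.
  by rewrite -t0 scale0r massless.
move=> t_gt0; split.
- exact: polyhedron_barycenter.
- apply: contrapT => /forallNP allP.
  suff t00 : t = 0 by rewrite t00 ltxx in t_gt0.
  by apply: big1 => k /allP.
- move=> d a dv; rewrite dot_barycenter ler_pdivlMl//.
  rewrite mulr_suml; apply: ler_sum => k Pk; rewrite ler_wpM2l//.
  exact: dv.
Qed.

(** * From costs to the suboptimality bound *)

(** By concavity the objective grows from [y] at most linearly, with gradient
    [c - B^T *m (B *m y)]. *)
Lemma quad_obj_segment_le (R : realType) (n r : nat) (B : 'M[R]_(r, n))
    (c y z : 'cV[R]_n) (t R1 : R) :
  0 <= t -> norm1 y <= R1 -> norm1 z <= R1 ->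
  quad_obj (B^T *m B) c ((1 - t) *: y + t *: z) - quad_obj (B^T *m B) c y <=
  t * (2 * (opnorm (B^T *m B) * R1 ^+ 2) + 2 * (norm2 c * R1)).
Proof.
move=> t0 yR zR.
have R10 : 0 <= R1 by exact: le_trans (norm1_ge0 y) yR.
have -> : 2 * (opnorm (B^T *m B) * R1 ^+ 2) + 2 * (norm2 c * R1) =
    (norm2 c + opnorm (B^T *m B) * R1) * (2 * R1) by ring.
have := quad_obj_le B c ((1 - t) *: y + t *: z) (B *m y).
rewrite (quad_obj_tight B c y); set g := c - _.
have -> : dot g ((1 - t) *: y + t *: z) = dot g y + t * dot g (z - y).
  by rewrite dotBr dotDr !dotZr; ring.
move=> upper.
suff : t * dot g (z - y) <=
    t * ((norm2 c + opnorm (B^T *m B) * R1) * (2 * R1)) by lra.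
rewrite ler_wpM2l//; apply: le_trans (cauchy_schwarz _ _) _.
rewrite ler_pM ?norm2_ge0//.
  rewrite /g mulmxA (le_trans (norm2D _ _))// lerD2l norm2N.
  rewrite (le_trans (norm2_mulmx_le _ _))// ler_wpM2l ?opnorm_ge0//.
  exact: le_trans (norm2_le_norm1 y) yR.
rewrite (le_trans (norm2D _ _))// norm2N mulr_natl mulr2n lerD//.
  exact: le_trans (norm2_le_norm1 z) zR.
exact: le_trans (norm2_le_norm1 y) yR.
Qed.

(** [2 * mu + 2 * nu] is at most twice the maximum, and the factor [2] is
    absorbed by [expR 1 >= 2], the gain of [entropic_segment_bound]. *)
Lemma suboptimality_constant (R : realType) (q mu nu t e : R) :
  0 <= mu -> 0 <= nu -> 0 <= t ->
  q <= t * (2 * mu + 2 * nu) -> t <= expR (e - 1) ->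
  q <= Num.max (4 * mu) (2 * nu) * expR e.
Proof.
move=> mu0 nu0 t0 qt te.
have te2 : 2 * t <= expR e.
  apply: (@le_trans _ _ (expR 1 * expR (e - 1))); last first.
    by rewrite -expRD; have -> : 1 + (e - 1) = e by ring.
  by rewrite ler_pM//; have := expR_ge1Dx (1 : R); lra.
apply: (le_trans qt); set K := Num.max _ _.
have K1 : 4 * mu <= K by rewrite le_max lexx.
have K2 : 2 * nu <= K by rewrite le_max lexx orbT.
have -> : t * (2 * mu + 2 * nu) = (mu + nu) * (2 * t) by ring.
by rewrite ler_pM//; lra.
Qed.

(** A threshold [a / r] with [r = 0] is [+oo] or nonpositive. *)
Lemma lt_div_mul (R : realType) (eps r : R) (a : \bar R) :
  0 < eps -> 0 <= r -> (eps%:E < a / r%:E)%E -> ((eps * r)%:E < a)%E.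
Proof.
move=> eps0; rewrite le_eqVlt => /predU1P[<-|r0]; last first.
  by rewrite inver gt_eqF// lte_pdivlMr.
rewrite inver eqxx mulr0 => epsa; rewrite ltNge; apply/negP => a0.
have : (a * +oo <= 0)%E by rewrite mule_le0_ge0.
by move=> /(lt_le_trans epsa); rewrite lte_fin ltNge (ltW eps0).
Qed.

Lemma lt_sqre (R : realType) (x : R) (g : \bar R) :
  0 <= x -> (0 <= g)%E -> ((x ^+ 2)%:E < g ^+ 2)%E -> (x%:E < g)%E.
Proof.
move=> x0; case: g => [g|_ _|]; [|exact: ltry|by []].
by rewrite lee_fin expe2 -EFinM !lte_fin -expr2 => g0; rewrite ltr_pXn2r.
Qed.

(** * Locating the minimizer in a cell *)

Lemma gamma_at_ge0 (R : realType) (n r V : nat) (B : 'M[R]_(r, n))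
    (c : 'cV[R]_n) (v : 'I_V -> 'cV[R]_n) (i : 'I_V) :
  (0 <= gamma_at B c v i)%E.
Proof.
by apply: le_ereal_inf_tmp => _ [z _ <-]; rewrite lee_fin norm2_ge0.
Qed.

(** On the cell of [v i] the dual function is the quadratic
    [quad_obj (v i) + 2^-1 * norm2 (u - B *m v i) ^+ 2]. Since its global
    minimum is the minimum of the objective, a cell that contains a dual
    minimizer contains [B *m v i], and [v i] is optimal. *)
Lemma Istar_optimal (R : realType) (m n r V : nat) (A : 'M[R]_(m, n))
    (b : 'cV[R]_m) (B : 'M[R]_(r, n)) (c : 'cV[R]_n)
    (v : 'I_V -> 'cV[R]_n) (i : 'I_V) :
  bounded_set (polyhedron A b) -> range v = vertices (polyhedron A b) ->
  Istar (polyhedron A b) B c v i ->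
  cell B c v i (B *m v i) /\
  forall j, quad_obj (B^T *m B) c (v i) <= quad_obj (B^T *m B) c (v j).
Proof.
move=> Kbd v_vert [u [ui [_ umin]]].
have g0_le j : g0 (polyhedron A b) B c u <= quad_obj (B^T *m B) c (v j).
  apply: (le_trans (umin (B *m v j) I)).
  have [k kmin] := exists_min_index
    (fun k => dot (c - B^T *m (B *m v j)) (v k)) j.
  have kj : cell B c v k (B *m v j) by move=> l _; exact: kmin.
  rewrite (g0_cell Kbd v_vert kj) (quad_obj_tight B c (v j)).
  rewrite (quad_obj_square B c (v k) (B *m v j)).
  by have := kmin j; lra.
rewrite (g0_cell Kbd v_vert ui) in g0_le.
have sq0 : 0 <= norm2 (u - B *m v i) ^+ 2 by exact: sqr_ge0.
split=> [|j]; last by have := g0_le j; lra.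
have : dot (u - B *m v i) (u - B *m v i) = 0.
  by rewrite -norm2_sqr; have := g0_le i; lra.
by move=> /dot_eq0/eqP; rewrite subr_eq0 => /eqP <-.
Qed.

(** The dual function is bounded below by the minimum of the objective, and
    on the cells outside of [Istar] it is higher by at least [alpha]. *)
Lemma lt_alpha_Istar (R : realType) (m n r V : nat) (A : 'M[R]_(m, n))
    (b : 'cV[R]_m) (B : 'M[R]_(r, n)) (c : 'cV[R]_n)
    (v : 'I_V -> 'cV[R]_n) (i i0 : 'I_V) (u : 'cV[R]_r) :
  bounded_set (polyhedron A b) -> range v = vertices (polyhedron A b) ->
  (forall j, quad_obj (B^T *m B) c (v i0) <= quad_obj (B^T *m B) c (v j)) ->
  cell B c v i u ->
  ((g0 (polyhedron A b) B c u - quad_obj (B^T *m B) c (v i0))%:E <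
    alpha (polyhedron A b) B c v)%E ->
  Istar (polyhedron A b) B c v i.
Proof.
move=> Kbd v_vert i0min ui u_alpha; apply: contrapT => i_notin.
move: u_alpha; apply/negP; rewrite -leNgt EFinB; apply: leeB.
  by apply: ereal_inf_lbound; exists u => //; exists i.
apply: le_ereal_inf_tmp => _ [w _ <-]; rewrite lee_fin.
have [k kmin] := exists_min_index (fun k => dot (c - B^T *m w) (v k)) i0.
have kw : cell B c v k w by move=> l _; exact: kmin.
rewrite (g0_cell Kbd v_vert kw); have := i0min k.
by have := sqr_ge0 (norm2 (w - B *m v k)); lra.
Qed.

(** * The exponential suboptimality bound *)

Unset Implicit Arguments.
Set Strict Implicit.

Theorem corollary1 (R : realType) (m n r V : nat)
    (A : 'M[R]_(m, n)) (b : 'cV[R]_m) (c : 'cV[R]_n)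
    (M : 'M[R]_n) (B : 'M[R]_(r, n)) (v : 'I_V -> 'cV[R]_n)
    (M_sym : M^T = M)
    (M_psd : forall x : 'cV[R]_n, 0 <= dot x (M *m x))
    (MB : M = B^T *m B)
    (r_le_n : (r <= n)%N)
    (K_nonempty : polyhedron A b !=set0)
    (K_bounded : bounded_set (polyhedron A b))
    (obj_nonconstant : exists x y : 'cV[R]_n,
      [/\ polyhedron A b x, polyhedron A b y &
          quad_obj M c x <> quad_obj M c y])
    (v_inj : injective v)
    (v_vertices : range v = vertices (polyhedron A b)) :
  let K := polyhedron A b in
  let RH := entropy_range K in
  let R1 := radius1 K in
  let D := Delta K B c v in
  forall (eps : R) (xeps : 'cV[R]_n),
    0 < eps ->
    (eps%:E < Order.min (alpha K B c v / RH)
               (Order.min (gamma K B c v ^+ 2 / (8%:E * RH))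
                          (D / (R1%:E + RH))))%E ->
    argmin K (entropic_obj M c eps) xeps ->
    let subopt := quad_obj M c xeps - inf [set quad_obj M c x | x in K] in
    0 <= subopt /\
    (subopt%:E <=
       (Num.max (4 * R1 ^+ 2 * opnorm M) (2 * norm2 c * R1))%:E
       * expeR (- D / (eps%:E * R1%:E) + (R1%:E + RH) / R1%:E))%E.
Proof.
move=> K RH R1 D eps xeps eps0 eps_lt [Kxeps xeps_min] subopt.
have Kpos x : K x -> forall i, 0 <= x i 0 by case.
have vK j : K (v j) by exact: range_vertices_mem.
have [rh [RHE rh0 rh_ub]] := entropy_range_fin K_bounded K_nonempty Kpos.
have R1_ub x : K x -> norm1 x <= R1 by exact: radius1_ub.
have R10 : 0 < R1.
  have [x [y [Kx Ky qxy]]] := obj_nonconstant.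
  have [x0|/norm2_gt0 x0] := pselect (x = 0); last first.
    exact: lt_le_trans x0 (le_trans (norm2_le_norm1 x) (R1_ub x Kx)).
  have [y0|/norm2_gt0 y0] := pselect (y = 0); first by rewrite x0 y0 in qxy.
  exact: lt_le_trans y0 (le_trans (norm2_le_norm1 y) (R1_ub y Ky)).
have [k0 _] : exists k : 'I_V, True.
  have [x Kx] := K_nonempty.
  have [p [_ p1 _]] := convex_combination_vertices K_bounded v_vertices Kx.
  apply: contrapT => /forallNP no_k; move: p1; rewrite big1; last first.
    by move=> k _; case: (no_k k).
  by move=> /eqP; rewrite eq_sym oner_eq0.
have [i0 i0min] := exists_min_index (fun j => quad_obj M c (v j)) k0.
have fstar_le x : K x -> quad_obj M c (v i0) <= quad_obj M c x.
  move=> Kx; rewrite MB; apply: (quad_obj_min_vertex K_bounded v_vertices) Kx.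
  by rewrite -MB.
have infE : inf [set quad_obj M c x | x in K] = quad_obj M c (v i0).
  exact: inf_attained.
have subopt0 : 0 <= subopt by rewrite /subopt infE subr_ge0 fstar_le.
split=> //.
have ent_min x : K x -> quad_obj M c xeps - eps * real_entropy xeps <=
                        quad_obj M c x - eps * real_entropy x.
  move=> Kx; have := xeps_min x Kx; rewrite /entropic_obj !entropyE//;
    exact: Kpos.
have {eps_lt} [eps_alpha eps_gamma eps_Delta] :
    [/\ ((eps * rh)%:E < alpha K B c v)%E,
        ((eps * (8 * rh))%:E < gamma K B c v ^+ 2)%E &
        ((eps * (R1 + rh))%:E < D)%E].
  move: eps_lt; rewrite !lt_min /RH RHE -EFinM -EFinD => /and3P[ea eg eD].
  split; apply: lt_div_mul => //; first by rewrite mulr_ge0.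
  by rewrite addr_ge0// ltW.
pose u := B *m xeps.
have [i imin] := exists_min_index (fun j => dot (c - B^T *m u) (v j)) k0.
have ui : cell B c v i u by move=> j _; exact: imin.
have dmin x : K x -> dot (c - B^T *m u) (v i) <= dot (c - B^T *m u) x.
  exact: linear_min_vertex imin _.
have xeps_near : quad_obj M c xeps <= quad_obj M c (v i0) + eps * rh.
  have := ent_min _ (vK i0).
  have := ler_wpM2l (ltW eps0) (rh_ub _ _ Kxeps (vK i0)); lra.
have g0_near : g0 K B c u <= quad_obj M c (v i0) + eps * rh.
  apply: le_trans xeps_near.
  rewrite (g0_cell K_bounded v_vertices ui) MB (quad_obj_square B c (v i) u).
  by rewrite (quad_obj_tight B c xeps) -/u; have := dmin _ Kxeps; lra.
have i_star : Istar K B c v i.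
  apply: (lt_alpha_Istar K_bounded v_vertices (i0 := i0) _ ui) => //.
    by rewrite -MB.
  by apply: le_lt_trans eps_alpha; rewrite lee_fin -MB; lra.
have [Ci] := Istar_optimal K_bounded v_vertices i_star.
rewrite -MB => i_opt.
have fi : quad_obj M c (v i) = quad_obj M c (v i0).
  by apply/eqP; rewrite eq_le i_opt i0min.
have u_near : ((2 * norm2 (u - B *m v i))%:E < gamma_at B c v i)%E.
  apply: (@lt_le_trans _ _ (gamma K B c v)); last first.
    by apply: ereal_inf_lbound; exists i.
  apply: lt_sqre; first by rewrite mulr_ge0 ?norm2_ge0.
    by apply: le_ereal_inf_tmp => _ [j _ <-]; exact: gamma_at_ge0.
  apply: le_lt_trans eps_gamma; rewrite lee_fin exprMn.
  have := g0_near; rewrite (g0_cell K_bounded v_vertices ui) -MB fi; lra.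
(* Vertices whose cost ties with that of [v i] at every dual point. *)
pose P := [pred k | (B *m v k == B *m v i) && (dot c (v k) == dot c (v i))].
have Pi : P i by rewrite /= !eqxx.
have gap k : ~~ P k -> (D <= (dot (c - B^T *m u) (v k - v i))%:E)%E.
  move=> Pk; apply: (@le_trans _ _ (Delta_at K B c v i)).
    by apply: ereal_inf_lbound; exists i.
  apply: Delta_gap => // -[/eqP Bk /eqP ck].
  by move: Pk; rewrite /= Bk ck.
have [t [y [z [t01 Ky xepsE y_face z_gap]]]] :=
  polyhedron_split K_bounded v_vertices Pi Kxeps.
have By : B *m y = B *m v i.
  apply/colP => j; rewrite !mulmx_dot; apply: y_face => k /andP[/eqP Bk _].
  by rewrite -!mulmx_dot Bk.
have cy : dot c y = dot c (v i) by apply: y_face => k /andP[_ /eqP].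
have fy : quad_obj M c y = quad_obj M c (v i0).
  by rewrite -fi MB !(quad_obj_square B c _ 0) By !dot_cost By cy.
have rhs_ge0 : 0 <= Num.max (4 * R1 ^+ 2 * opnorm M) (2 * norm2 c * R1).
  by rewrite le_max; apply/orP; right; rewrite !mulr_ge0 ?norm2_ge0// ltW.
have [t0|t0] : t = 0 \/ 0 < t.
  by case/andP: t01; rewrite le_eqVlt => /predU1P[<-|]; [left|right].
  have -> : subopt = 0.
    by rewrite /subopt infE xepsE t0 subr0 scale1r scale0r addr0 fy subrr.
  by rewrite mule_ge0 ?lee_fin ?expeR_ge0.
have [Kz [k Pk] z_far] := z_gap t0.
(* A vertex outside of [P] carries mass, which makes [D] finite. *)
have [Dr DE] : exists Dr, D = Dr%:E.
  have := gap k Pk; case: D eps_Delta {gap} => [Dr| |]//=; by exists Dr.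
have Dz : Dr <= dot (c - B^T *m u) (z - y).
  have -> : dot (c - B^T *m u) (z - y) =
      dot (c - B^T *m u) z - dot (c - B^T *m u) (v i).
    by rewrite dotBr !dot_cost By cy.
  rewrite lerBrDr; apply: z_far => j /gap; rewrite DE lee_fin dotBr; lra.
have t_le : t <= expR (- Dr / (eps * R1) + rh / R1).
  apply: (@entropic_segment_bound _ _ y z (c - B^T *m u)) => //.
  - exact: Kpos.
  - exact: Kpos.
  - by rewrite t0; case/andP: t01.
  - exact: R1_ub.
  - exact: R1_ub.
  - exact: rh_ub.
  - by move: eps_Delta; rewrite DE lte_fin.
  move=> s /andP[s0 st]; rewrite -xepsE.
  set w := (1 - s) *: y + s *: z.
  have Kw : K w.
    have := polyhedron_conv (t := s) Kz Ky; rewrite addrC; apply.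
    by rewrite ltW//=; case/andP: t01; lra.
  have := ent_min w Kw; rewrite MB (quad_obj_tight B c xeps) -/u.
  by have := quad_obj_le B c w u; lra.
rewrite DE /RH RHE -EFinN -!EFinM -!EFinD.
rewrite !inver !mulf_eq0 !(gt_eqF eps0) !(gt_eqF R10)/= -EFinM.
rewrite lee_fin.
have -> : 4 * R1 ^+ 2 * opnorm M = 4 * (opnorm M * R1 ^+ 2) by ring.
have -> : 2 * norm2 c * R1 = 2 * (norm2 c * R1) by ring.
apply: (suboptimality_constant (t := t)) => //.
- by rewrite mulr_ge0 ?opnorm_ge0 ?sqr_ge0.
- by rewrite mulr_ge0 ?norm2_ge0// ltW.
- exact: ltW.
- rewrite /subopt infE -fy xepsE MB.
  by apply: quad_obj_segment_le; [exact: ltW|exact: R1_ub|exact: R1_ub].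
- suff <- : - Dr / (eps * R1) + rh / R1 =
      - Dr / (eps * R1) + (R1 + rh) / R1 - 1 by [].
  by field; rewrite !gt_eqF.
Qed.
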